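(* There exists a countable regular maximal space which is D-separable and not selectively separable.
   Context: Regular spaces are $T_1$. A space is crowded if it has no isolated points. A space is maximal if it is crowded and no strictly stronger (finer) topology on the same set is crowded. A subset is discrete if it is discrete in its subspace topology. $X$ is D-separable (respectively, selectively separable) if for every sequence $(D_n:n\in\omega)$ of dense subspaces of $X$ one can pick discrete (respectively, finite) sets $F_n\subset D_n$ so that $\bigcup_{n\in\omega}F_n$ is dense in $X$. *)

(* Defs.v *)
From HB Require Import structures.
From mathcomp Require Import all_boot all_classical topology.

Set Implicit Arguments.
Unset Strict Implicit.
Unset Printing Implicit Defensive.

Local Open Scope classical_set_scope.

Definition crowded (X : topologicalType) : Prop :=
  isolated [set: X] = set0.

(* [c] ranges over all topological structures on the carrier of [X]. *)
Definition maximal_space (X : topologicalType) : Prop :=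
  crowded X /\
  forall c : Topological X,
    let Y : topologicalType := Topological.Pack c in
    @open X `<` @open Y -> ~ crowded Y.

(* [subspace A] has the carrier of the whole space, with every point outside
   [A] made isolated, so all its subsets are open exactly when the subspace
   topology of [A] is discrete. *)
Definition discrete_subset (X : topologicalType) (A : set X) : Prop :=
  forall B : set (subspace A), open B.

(* [regular_space] does not include the T1 axiom. *)
Definition regular_T1 (X : topologicalType) : Prop :=
  accessible_space X /\ regular_space X.

Definition D_separable (X : topologicalType) : Prop :=
  forall D : nat -> set X, (forall n, dense (D n)) ->
  exists F : nat -> set X,
    (forall n, discrete_subset (F n) /\ F n `<=` D n) /\
    dense (\bigcup_n F n).

Definition selectively_separable (X : topologicalType) : Prop :=
  forall D : nat -> set X, (forall n, dense (D n)) ->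
  exists F : nat -> set X,
    (forall n, finite_set (F n) /\ F n `<=` D n) /\
    dense (\bigcup_n F n).

(* Main.v *)
Require Import Defs.
From HB Require Import structures.
From mathcomp Require Import all_boot all_classical topology.

Local Open Scope classical_set_scope.

(** Call a subset of [pt] small if, in all but finitely many columns, it is bounded.
Altering an independent family of sets on small sets only, one gets a zero-dimensional
crowded topology on [pt] in which every small set is closed and discrete; this persists
in finer topologies and in subspaces. The first [n] columns form a small set, and so
does a union of finite sets [F n] with [F n] outside the first [n] columns: hence no
crowded subspace of a finer topology is selectively separable.

By Zorn's lemma, refine to a maximal algebra [B] of clopen sets without isolated points.
Disjoint dense-in-itself sets are then separated by [B]. As in van Douwen's argument,
the points that are not limits of discrete sets are not scattered, and any
dense-in-itself set [Y] of such points is a maximal space.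

In a maximal space, every set with dense complement is discrete. Given dense sets
[D n], whose finite intersections [E n] are dense and open, the discrete sets
[E n \ E n.+1], each enlarged by one point of the intersection of all [E n], cover
[E 0]. *)

(** * Algebras of clopen sets and maximal crowded algebras *)

Section SetAlgebra.
Context {X : Type}.
Implicit Types (B : set (set X)) (C D N S : set X).

(** [B] is read as a base of a topology; closure under complement makes its members clopen. *)
Definition set_algebra B :=
  [/\ B setT, forall b, B b -> B (~` b) & forall b c, B b -> B c -> B (b `&` c)].

Definition dense_in_itself B C :=
  forall x b, C x -> B b -> b x -> exists y, [/\ C y, b y & y <> x].

Definition adherent B C x := forall b, B b -> b x -> exists2 y, C y & b y.

Definition scattered B N :=
  forall C, C `<=` N -> dense_in_itself B C -> C = set0.

Definition discrete_in B D :=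
  forall x, D x -> exists b, [/\ B b, b x & forall y, b y -> D y -> y = x].

(** Maximality concerns only crowded topologies with a clopen base; arbitrary finer topologies are
    dealt with later, by passing to a subset. *)
Definition maximal_algebra B :=
  [/\ set_algebra B, dense_in_itself B setT & forall B', set_algebra B' ->
      dense_in_itself B' setT -> B `<=` B' -> B' `<=` B].

Lemma set_algebraU B b c : set_algebra B -> B b -> B c -> B (b `|` c).
Proof.
move=> [_ BC BI] Bb Bc; rewrite -[_ `|` _]setCK setCU.
by apply/BC/BI; apply/BC.
Qed.

Lemma maximal_algebra_exists B0 : set_algebra B0 -> dense_in_itself B0 setT ->
  exists2 B, maximal_algebra B & B0 `<=` B.
Proof.
move=> alg0 dii0.
(* The alternative [B = set0] admits the union of the empty chain. It is never maximal, since [B0]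
   contains [setT]. *)
pose P B := B = set0 \/ [/\ set_algebra B, dense_in_itself B setT & B0 `<=` B].
have [F FP Ftot|B [PB Bmax]] := @Zorn_bigcup (set X) P.
  have [[B1 FB1 B1n0]|Fempty] := pselect (exists2 B, F B & B <> set0); last first.
    left; apply/seteqP; split=> // b [B FB Bb].
    by apply: Fempty; exists B => // B0'; rewrite B0' in Bb.
  have good B b : F B -> B b ->
      [/\ set_algebra B, dense_in_itself B setT & B0 `<=` B].
    by move=> FB Bb; case: (FP _ FB) => // B0'; rewrite B0' in Bb.
  have [[B1T _ _] _ B01]: [/\ set_algebra B1, dense_in_itself B1 setT & B0 `<=` B1].
    by case: (FP _ FB1).
  right; split; last by move=> b /B01 B1b; exists B1.
  - split; first by exists B1.
    + by move=> b [B FB Bb]; have [[_ BC _] _ _] := good _ _ FB Bb; exists B => //; apply: BC.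
    + move=> b c [B FB Bb] [B' FB' B'c].
      have [[_ _ BI] _ _] := good _ _ FB Bb.
      have [[_ _ BI'] _ _] := good _ _ FB' B'c.
      by case: (Ftot _ _ FB FB') => sub; [exists B' => //; apply: BI' => //; apply: sub
        |exists B => //; apply: BI => //; apply: sub].
  - by move=> x b _ [B FB Bb]; have [_ dii _] := good _ _ FB Bb; apply: dii.
case: PB => [B_0|[alg dii B0B]].
  exfalso; apply: (Bmax B0); last by right; split.
  rewrite B_0; split; first exact: sub0set.
  by move=> sub; have [B0T _ _] := alg0; exact: sub B0T.
exists B => //; split=> // B' alg' dii' BB' b B'b; apply: contrapT => nBb.
apply: (Bmax B'); last by right; split=> // c /B0B /BB'.
by split=> // sub; apply: nBb; apply: sub.
Qed.

(** The algebra generated by [B] and [C] consists of the sets equal to some [b] on [C] and to some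
    [c] off [C]. It has no isolated points because neither [C] nor its complement has any. *)
Lemma maximal_algebra_mem B C : maximal_algebra B ->
  dense_in_itself B C -> dense_in_itself B (~` C) -> B C.
Proof.
move=> [[BT BC BI] diiT Bmax] diiC diinC.
pose B' := [set s | exists b c, [/\ B b, B c & s = (b `&` C) `|` (c `\` C)]].
have BB' : B `<=` B'.
  move=> b Bb; exists b, b; split=> //; apply/seteqP; split=> x /=; last by case=> [[]|[]].
  by have [] := pselect (C x); [left|right].
apply: (Bmax B') => //; last first.
- exists setT, (~` setT); split=> //; first exact: BC.
  by apply/seteqP; split=> x /=; [left|case=> -[]].
- move=> x s _ [b [c [Bb Bc ->]]] [[bx Cx]|[cx nCx]].
  + by have [y [Cy by' yx]] := diiC _ _ Cx Bb bx; exists y; split=> //; left.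
  + by have [y [Cy by' yx]] := diinC _ _ nCx Bc cx; exists y; split=> //; right.
split; first exact: BB'.
- move=> s [b [c [Bb Bc ->]]]; exists (~` b), (~` c); split; try exact: BC.
  apply/seteqP; split=> x /=.
    move=> h; have [Cx|Cx] := pselect (C x); [left|right]; split=> // h'; apply: h; [by left|by right].
  by move=> [[nb Cx]|[nc Cx]] [[]|[]].
- move=> s s' [b [c [Bb Bc ->]]] [b' [c' [Bb' Bc' ->]]].
  exists (b `&` b'), (c `&` c'); split; try exact: BI.
  apply/seteqP; split=> x /=; last by move=> [[[? ?] ?]|[[? ?] ?]]; split; [left|left|right|right].
  by move=> [[[? ?]|[? ?]] [[? ?]|[? ?]]] //; [left|right].
Qed.

(* The separating set is the closure of [C] minus [D]: it and its complement are
   both dense in themselves, so it belongs to the maximal algebra. *)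
Lemma separate_dense_in_itself B C D : maximal_algebra B ->
  dense_in_itself B C -> dense_in_itself B D -> C `&` D = set0 ->
  exists b, [/\ B b, C `<=` b & b `&` D = set0].
Proof.
move=> Bmax; have [[BT BC BI] diiT _] := Bmax => diiC diiD CD.
have nD x : C x -> ~ D x by move=> Cx Dx; rewrite -[False]/(set0 x) -CD.
exists (adherent B C `\` D); split; last by apply/seteqP; split=> x // [[]].
- apply: maximal_algebra_mem => // x b.
  + move=> [adhx nDx] Bb bx.
    have [y [Cy by' yx]] : exists y, [/\ C y, b y & y <> x].
      have [Cx|nCx] := pselect (C x); first exact: diiC.
      by have [y Cy by'] := adhx _ Bb bx; exists y; split=> // yx; rewrite -yx in nCx.
    exists y; split=> //; split; last exact: nD.
    by move=> b' _ b'y; exists y.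
  + move=> nx Bb bx; have [Dx|nDx] := pselect (D x).
      by have [y [Dy by' yx]] := diiD _ _ Dx Bb bx; exists y; split=> // -[].
    have : ~ adherent B C x by move=> adhx; apply: nx.
    move=> /existsNP[b' /not_implyP[Bb' /not_implyP[b'x nb']]].
    have [y [_ [by' b'y] yx]] := diiT x (b `&` b') I (BI _ _ Bb Bb') (conj bx b'x).
    exists y; split=> // -[adhy _]; apply: nb'; exact: adhy.
- by move=> x Cx; split; [move=> b _ bx; exists x|exact: nD].
Qed.

(** Cantor-Bendixson decomposition without ordinals: the removed kernel is the union of all
    dense-in-itself subsets of [S]. *)
Lemma scattered_setD_kernel B S :
  scattered B (S `\` [set x | exists C, [/\ C `<=` S, dense_in_itself B C & C x]]).
Proof.
move=> C sub diiC; apply/seteqP; split=> // x Cx.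
by have [Sx] := sub _ Cx; apply; exists C; split=> // y /sub [].
Qed.

Lemma dense_in_itself_kernel B S :
  dense_in_itself B [set x | exists C, [/\ C `<=` S, dense_in_itself B C & C x]].
Proof.
move=> x b [C [CS diiC Cx]] Bb bx; have [y [Cy by' yx]] := diiC _ _ Cx Bb bx.
by exists y; split=> //; exists C.
Qed.

(** Take for [D] the isolated points of [N]: every nonempty trace [N] on a member of [B] is
    scattered, so it contains one. *)
Lemma scattered_discrete_dense B N : set_algebra B -> scattered B N ->
  exists D, [/\ D `<=` N, discrete_in B D & forall x, adherent B N x -> adherent B D x].
Proof.
move=> [BT BC BI] scN.
exists [set x | N x /\ exists b, [/\ B b, b x & forall y, b y -> N y -> y = x]].
split=> [x []//|x [Nx [b [Bb bx bN]]]|x adhx b Bb bx].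
  by exists b; split=> // y by' [Ny _]; exact: bN.
have [y Ny by'] := adhx _ Bb bx.
have : ~ dense_in_itself B (N `&` b).
  by move=> /(scN _ (@subIsetl _ N b)) e; rewrite -[False]/(set0 y) -e.
move=> /existsNP[z /existsNP[c /not_implyP[[Nz bz] /not_implyP[Bc /not_implyP[cz nz]]]]].
exists z => //; split=> //; exists (b `&` c); split=> [||w [bw cw] Nw] //; first exact: BI.
by apply: contrapT => wz; apply: nz; exists w.
Qed.

(* A scattered set is nowhere dense because a dense subset of an open set is
   dense in itself. *)
Lemma scattered_not_adherent B N : set_algebra B -> dense_in_itself B setT ->
  (forall x y, x <> y -> exists b, [/\ B b, b x & ~ b y]) ->
  [set: X] !=set0 -> scattered B N -> exists x, ~ adherent B N x.
Proof.
move=> [BT BC BI] diiT T1 [x0 _] scN; apply: contrapT => /forallNP adh.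
have {}adh x : adherent B N x by apply: contrapT; exact: adh.
have : N = set0.
  apply: scN => // x b Nx Bb bx.
  have [y [_ by' yx]] := diiT _ _ I Bb bx.
  have [c [Bc cy ncx]] := T1 _ _ yx.
  have [z Nz [bz cz]] := adh y _ (BI _ _ Bb Bc) (conj by' cy).
  by exists z; split=> // zx; rewrite zx in cz.
by move=> N0; have [y] := adh x0 _ BT I; rewrite N0.
Qed.

End SetAlgebra.

(** * Trees of discrete sets: not every point of a nonempty set can be a limit of a discrete
    subset *)

Section Tree.
Context {X : countType} (B : set (set X)) (W : set X).
Hypothesis Bmax : maximal_algebra B.
Hypothesis limW : forall x, W x -> exists D,
  [/\ D `<=` W, discrete_in B D, ~ D x & adherent B D x].
Hypothesis T1B : forall x y : X, x <> y -> exists b, [/\ B b, b x & ~ b y].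

(** Run through [D] in the order of [pickle] and remove from each neighbourhood the earlier ones;
    they are finitely many, so the result stays in [B]. *)
Lemma discrete_disjoint_nbhs D : discrete_in B D -> exists c : X -> set X,
  (forall y, D y -> B (c y) /\ c y y) /\
  (forall y y' z, D y -> D y' -> c y z -> c y' z -> y = y').
Proof.
have [alg _ _] := Bmax; have [BT BC BI] := alg.
move=> disD; have /choice[b bP] : forall x, exists b, D x ->
    [/\ B b, b x & forall y, b y -> D y -> y = x].
  by move=> x; have [/disD[b]|?] := pselect (D x); [exists b|exists setT].
pose u n := [set z | exists y, [/\ D y, b y z & pickle y < n]].
have Bu n : B (u n).
  elim: n => [|n IH].
    rewrite (_ : u 0 = ~` setT); first exact: BC.
    by apply/seteqP; split=> [z [y []]|z []].
  have [[y Dy yn]|nex] := pselect (exists2 y, D y & pickle y = n).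
    rewrite (_ : u n.+1 = u n `|` b y).
      by apply: set_algebraU => //; have [] := bP _ Dy.
    apply/seteqP; split=> [z [y' [Dy' by' ]]|z [[y' [Dy' by' lt]]|byz]].
    - rewrite ltnS leq_eqVlt => /orP[/eqP e|lt]; last by left; exists y'.
      by right; rewrite -yn in e; rewrite -(pcan_inj pickleK e).
    - by exists y'; split=> //; exact: leq_trans lt _.
    - by exists y; split=> //; rewrite yn.
  rewrite (_ : u n.+1 = u n) //.
  apply/seteqP; split=> [z [y' [Dy' by' ]]|z [y' [Dy' by' lt]]].
    rewrite ltnS leq_eqVlt => /orP[/eqP e|lt]; last by exists y'.
    by exfalso; apply: nex; exists y'.
  by exists y'; split=> //; exact: leq_trans lt _.
exists (fun y => b y `&` ~` u (pickle y)); split=> [y Dy|y y' z Dy Dy'].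
  have [Bb byy _] := bP _ Dy; split; first by apply: BI => //; apply: BC.
  split=> // -[y' [Dy' by' lt]]; have [_ _ /(_ _ by' Dy) e] := bP _ Dy'.
  by rewrite e ltnn in lt.
move=> [bz nuz] [b'z nu'z]; apply: (pcan_inj (@pickleK X)).
case: (ltngtP (pickle y) (pickle y')) => // lt; exfalso.
  by apply: nu'z; exists y.
by apply: nuz; exists y'.
Qed.

(** A node is a point with a clopen piece around it; [q.1] holds its children and [q.2] their
    pieces. The premises follow the existential so that [choice] yields a total function. *)
Lemma tree_step (p : X * set X) : exists q : set X * (X -> set X),
  W p.1 -> B p.2 -> p.2 p.1 -> [/\ adherent B q.1 p.1,
   forall y, q.1 y -> [/\ W y, B (q.2 y), q.2 y y, q.2 y `<=` p.2 & ~ q.2 y p.1] &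
   forall y y' z, q.1 y -> q.1 y' -> q.2 y z -> q.2 y' z -> y = y'].
Proof.
have [alg _ _] := Bmax; have [BT BC BI] := alg.
case: p => x b /=.
have [[Wx Bb bx]|n] := pselect [/\ W x, B b & b x]; last first.
  by exists (set0, fun=> set0) => *; exfalso; apply: n.
have [D [DW disD nDx adhx]] := limW _ Wx.
have [c [cP cdis]] := discrete_disjoint_nbhs _ disD.
have /choice[a aP] : forall y, exists a, y <> x -> [/\ B a, a y & ~ a x].
  by move=> y; have [->|/T1B[a ?]] := pselect (y = x); [exists setT|exists a].
exists (D `&` b, fun y => c y `&` (b `&` a y)) => _ _ _ /=; split.
- move=> d Bd dx; have [y Dy [dy by']] := adhx _ (BI _ _ Bd Bb) (conj dx bx).
  by exists y.
- move=> y [Dy by']; have [Bc cy] := cP _ Dy.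
  have yx : y <> x by move=> yx; rewrite yx in Dy.
  have [Ba ay nax] := aP _ yx.
  split=> //; [exact: DW|by apply/BI => //; apply/BI|by move=> z [_ []]|by move=> [_ []]].
- by move=> y y' z [Dy _] [Dy' _] [cyz _] [cy'z _]; exact: cdis cyz cy'z.
Qed.

(* Grow a tree from [x]: the children of a node form a discrete set clustering at
   it, inside disjoint clopen pieces. The even and the odd levels are disjoint,
   dense in themselves, and have [x] in both closures. *)
Lemma no_discrete_limits_everywhere : W = set0.
Proof.
apply/seteqP; split=> // x0 Wx0.
have [alg _ _] := Bmax; have [BT BC BI] := alg.
have [q qP] := choice tree_step.
(* [lev n x b]: the point [x] is a node of level [n] with piece [b]. *)
pose lev := fix lev n (x : X) (b : set X) {struct n} : Prop := match n with
  | 0 => x = x0 /\ b = setT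
  | m.+1 => exists y c, [/\ lev m y c, (q (y, c)).1 x & b = (q (y, c)).2 x]
  end.
have lev0 x b : lev 0 x b <-> x = x0 /\ b = setT by [].
have levS n x b : lev n.+1 x b <->
  exists y c, [/\ lev n y c, (q (y, c)).1 x & b = (q (y, c)).2 x] by [].
clearbody lev.
have levP n x b : lev n x b -> [/\ W x, B b & b x].
  elim: n x b => [x b /lev0[-> ->]|n IH x b /levS[y [c [/IH[Wy Bc cy] Dx ->]]]] //.
  by have [_ /(_ _ Dx)[]] := qP (y, c) Wy Bc cy.
have lev_inj n x b y c z : lev n x b -> lev n y c -> b z -> c z -> x = y /\ b = c.
  elim: n x b y c => [x b y c /lev0[-> ->] /lev0[-> ->]|n IH x b y c] //.
  move=> /levS[x' [b' [lx Dx ->]]] /levS[y' [c' [ly Dy ->]]] bz cz.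
  have [Wx Bb bx] := levP _ _ _ lx; have [Wy Bc cy] := levP _ _ _ ly.
  have [_ hx disx] := qP (x', b') Wx Bb bx.
  have [_ hy _] := qP (y', c') Wy Bc cy.
  have [_ _ _ subx _] := hx _ Dx; have [_ _ _ suby _] := hy _ Dy.
  have [xx bb] := IH _ _ _ _ lx ly (subx _ bz) (suby _ cz); subst y' c'.
  by rewrite (disx _ _ _ Dx Dy bz cz).
have lev_anc n k y c : lev (k.+1 + n) y c ->
    exists x b, [/\ lev n x b, c `<=` b & ~ c x].
  elim: k y c => [|k IH] y c /levS[y' [c' [ly Dy ->]]];
    have [Wy Bc cy] := levP _ _ _ ly;
    have [_ /(_ _ Dy)[_ _ _ sub nc] _] := qP (y', c') Wy Bc cy.
    by exists y', c'.
  have [x [b [lx c'b nc'x]]] := IH _ _ ly.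
  by exists x, b; split=> // [z /sub/c'b //|/sub].
(* If [x] recurred at a deeper level, [lev_inj] would make it its own ancestor, yet a piece omits
   the ancestors of its node. *)
have lev_lt n m x b c : n < m -> lev n x b -> lev m x c -> False.
  move=> nm lx; rewrite -(subnK nm) addnS -addSn => lx'.
  have [y [d [ly cd ncy]]] := lev_anc _ _ _ _ lx'.
  have [_ _ bx] := levP _ _ _ lx; have [_ _ cx] := levP _ _ _ lx'.
  by have [xy _] := lev_inj _ _ _ _ _ _ lx ly bx (cd _ cx); rewrite xy in cx.
have lev_uniq n m x b c : lev n x b -> lev m x c -> n = m.
  by move=> l1 l2; case: (ltngtP n m) => // lt; exfalso; [exact: lev_lt lt l1 l2|exact: lev_lt lt l2 l1].
have lev_next n x b u : lev n x b -> B u -> u x -> exists y c, lev n.+1 y c /\ u y.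
  move=> lx Bu ux; have [Wx Bb bx] := levP _ _ _ lx.
  have [/(_ _ Bu ux)[y Dy uy] _ _] := qP (x, b) Wx Bb bx.
  by exists y, ((q (x, b)).2 y); split=> //; apply/levS; exists x, b.
pose E (p : bool) := [set x | exists n b, lev n x b /\ odd n = p].
have diiE p : dense_in_itself B (E p).
  move=> x u [n [b [lx pn]]] Bu ux.
  (* Two levels down the parity is the same but the level differs, so the node found there is not
     [x]. *)
  have [y [c [ly uy]]] := lev_next _ _ _ _ lx Bu ux.
  have [z [d [lz uz]]] := lev_next _ _ _ _ ly Bu uy.
  exists z; split=> //; first by exists n.+2, d; rewrite /= negbK.
  move=> zx; rewrite zx in lz.
  by have := lev_uniq _ _ _ _ _ lz lx => /eqP; rewrite -addn2 -{2}[n]addn0 eqn_add2l.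
have Edis : E false `&` E true = set0.
  apply/seteqP; split=> // x [[n [b [lx pn]]] [m [c [lx' pm]]]].
  by have nm := lev_uniq _ _ _ _ _ lx lx'; rewrite nm pm in pn.
have [u [Bu Eu uE]] := separate_dense_in_itself _ _ _ Bmax (diiE _) (diiE _) Edis.
have l0 : lev 0 x0 setT by exact/lev0.
have ux0 : u x0 by apply: Eu; exists 0, setT.
have [y [c [ly uy]]] := lev_next _ _ _ _ l0 Bu ux0.
by have : set0 y by rewrite -uE; split=> //; exists 1, c.
Qed.

End Tree.

(** * A subset whose dense-in-itself subsets are relatively open *)

Lemma maximal_subset_exists (X : countType) (B : set (set X)) :
  maximal_algebra B ->
  (forall x y : X, x <> y -> exists b, [/\ B b, b x & ~ b y]) ->
  [set: X] !=set0 ->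
  exists Y, [/\ Y !=set0, dense_in_itself B Y & forall C, C `<=` Y ->
    dense_in_itself B C -> forall x, C x ->
    exists b, [/\ B b, b x & Y `&` b `<=` C]].
Proof.
move=> Bmax T1 Xn0; have [alg diiT _] := Bmax; have [BT BC BI] := alg.
pose G : set X := [set x | forall D, discrete_in B D -> ~ D x -> ~ adherent B D x].
have [Y [YG diiY Yn0]] : exists Y, [/\ Y `<=` G, dense_in_itself B Y & Y !=set0].
  apply: contrapT => nY.
  have scG : scattered B G.
    by move=> C CG diiC; apply: contrapT => /eqP/set0P Cn0; apply: nY; exists C.
  have [x0 nadh] := scattered_not_adherent _ _ alg diiT T1 Xn0 scG.
  suff e : ~` adherent B G = set0 by rewrite -[False]/(set0 x0) -e.
  (* [W] is the complement of the closure of [G]. Its points are limits of discrete sets, which can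
     be cut down to lie inside [W]. *)
  apply: (no_discrete_limits_everywhere B) => // x nx.
  have nGx : ~ G x by move=> Gx; apply: nx => b _ bx; exists x.
  move: nx => /existsNP[b /not_implyP[Bb /not_implyP[bx nb]]].
  move: nGx => /existsNP[D /not_implyP[disD /not_implyP[nDx /contrapT adhx]]].
  exists (D `&` b); split.
  - by move=> y [Dy by'] adhy; apply: nb; exact: adhy.
  - move=> y [Dy _]; have [c [Bc cy cD]] := disD _ Dy.
    by exists c; split=> // z cz [Dz _]; exact: cD.
  - by case.
  - move=> c Bc cx; have [y Dy [cy by']] := adhx _ (BI _ _ Bc Bb) (conj cx bx).
    by exists y.
exists Y; split=> // C CY diiC x Cx.
(* [Y] minus [C] splits into its kernel [K], which [B] separates from [C], and a scattered rest. The
   rest lies in the closure of a discrete set, of which [x], a point of [G] outside it, is not a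
   limit. *)
pose K := [set x | exists D, [/\ D `<=` Y `\` C, dense_in_itself B D & D x]].
have CK : C `&` K = set0.
  by apply/seteqP; split=> // y [Cy [D [DYC _ /DYC[_ nCy]]]].
have [b [Bb Cb bK]] :=
  separate_dense_in_itself _ _ _ Bmax diiC (dense_in_itself_kernel B (Y `\` C)) CK.
have [D [DN disD adhD]] :=
  scattered_discrete_dense _ _ alg (scattered_setD_kernel B (Y `\` C)).
have : ~ adherent B ((Y `\` C) `\` K) x.
  move=> /adhD; apply: (YG _ (CY _ Cx)) => // Dx.
  by have [[_ nCx] _] := DN _ Dx.
move=> /existsNP[c /not_implyP[Bc /not_implyP[cx nc]]].
exists (b `&` c); split; [exact: BI|by split=> //; exact: Cb|].
move=> y [Yy [by' cy]]; apply: contrapT => nCy; apply: nc; exists y => //.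
by split=> // Ky; rewrite -[False]/(set0 y) -bK.
Qed.

(** * The starting algebra on a countable set *)

Lemma eventually_all (A : eqType) (l : seq A) (P : A -> nat -> Prop) :
  (forall a, a \in l -> exists K, forall k, K <= k -> P a k) ->
  exists K, forall k, K <= k -> forall a, a \in l -> P a k.
Proof.
elim: l => [_|a l IH h]; first by exists 0.
have [b bl|K KP] := IH; first by apply: h; rewrite inE bl orbT.
have [K' K'P] := h a (mem_head _ _).
exists (maxn K K') => k; rewrite geq_max => /andP[Kk K'k] b.
by rewrite inE => /predU1P[->|]; [exact: K'P|exact: KP].
Qed.

(* A point [(n, (k, h))] lies in column [n]; [h] lists the keys
   [(pickle x, first k bits of J)] of the index pairs [(x, J)] whose
   independent set contains the point. *)
Definition pt : countType := (nat * (nat * seq (nat * bitseq)))%type.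

Definition small (J : set pt) :=
  exists N, forall n, N <= n -> exists M, forall k h, J (n, (k, h)) -> k < M.

Definition key (i : pt * set pt) (k : nat) : nat * bitseq :=
  (pickle i.1, mkseq (fun m => `[< exists2 y, i.2 y & pickle y = m >]) k).

(** The independent set of index [(x, J)], altered by deleting [J] and adding [x]; thus it is a
    neighbourhood of [x] that meets [J] at most in [x]. *)
Definition nbh (i : pt * set pt) (z : pt) : Prop :=
  z = i.1 \/ (~ i.2 z /\ key i z.2.1 \in z.2.2).

(** The Boolean algebra generated by the [nbh i] with [i.2] small, encoded as dependence on finitely
    many of them, which spares Boolean terms. *)
Definition start_algebra : set (set pt) := [set b | exists2 l : seq (pt * set pt),
  forall i, i \in l -> small i.2 &
  forall z z', (forall i, i \in l -> (nbh i z <-> nbh i z')) -> b z -> b z'].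

Lemma small1 x : small [set x].
Proof. by exists 0 => n _; exists x.2.1.+1 => k h <-. Qed.

Lemma start_algebraP : set_algebra start_algebra.
Proof.
split; first by exists [::].
- move=> b [l lsm lP]; exists l => // z z' zz' nbz bz'; apply: nbz.
  by apply: lP bz' => i il; split=> h; apply/(zz' _ il).
- move=> b c [l lsm lP] [l' lsm' lP']; exists (l ++ l').
    by move=> i; rewrite mem_cat => /orP[/lsm|/lsm'].
  move=> z z' zz' [bz cz]; split; [apply: lP bz|apply: lP' cz] => i il;
    by apply: zz'; rewrite mem_cat il ?orbT.
Qed.

Lemma start_algebra_small J x : small J ->
  exists b, [/\ start_algebra b, b x & forall y, b y -> J y -> y = x].
Proof.
move=> smJ; exists (nbh (x, J)); split; last by move=> y [//|[]].
- exists [:: (x, J)] => [i|z z' zz' nz]; first by rewrite inE => /eqP ->.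
  by apply/zz' => //; rewrite inE.
- by left.
Qed.

(** Sets that differ at [y] have different bit lists once [k] exceeds [pickle y]. *)
Lemma key_eventually_inj i j :
  exists K, forall k, K <= k -> key i k = key j k -> i = j.
Proof.
case: i j => x J [x' J'].
have [[y yP]|JJ'] := pselect (exists y, ~ (J y <-> J' y)).
  exists (pickle y).+1 => k lt [_ /(congr1 (fun s => nth false s (pickle y)))].
  rewrite !nth_mkseq // => e; exfalso; apply: yP.
  have h (L : set pt) : L y <-> exists2 y0, L y0 & pickle y0 = pickle y.
    by split=> [Ly|[y0 Ly0 /(pcan_inj (@pickleK _)) <-]] //; exists y.
  by split=> [/(h J)|/(h J')] /asboolP; [rewrite e|rewrite -e] => /asboolP ?; exact/h.
exists 0 => k _ [/(pcan_inj (@pickleK _)) -> _]; congr pair.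
apply/seteqP; split=> y; have /contrapT : ~ ~ (J y <-> J' y) by
  move=> n; apply: JJ'; exists y.
  by case.
by case.
Qed.

(* In a late column and for large [k], the points avoid the small sets of the
   finitely many indices involved, so membership is decided by [h] alone. *)
Lemma start_algebra_dense : dense_in_itself start_algebra setT.
Proof.
move=> z b _ [l lsm lP] bz.
have [n nP] : exists n, forall i, i \in l -> exists M, forall k h, i.2 (n, (k, h)) -> k < M.
  have [|N NP] := eventually_all _ l (fun i n => exists M, forall k h, i.2 (n, (k, h)) -> k < M).
    by move=> i /lsm.
  by exists N => i il; exact: NP.
have [i il|K1 K1P] := eventually_all _ l (fun i k => forall h, ~ i.2 (n, (k, h))).
  have [M MP] := nP i il; exists M => k Mk h /MP.
  by rewrite ltnNge Mk.
have [i il|K2 K2P] := eventually_all _ l (fun i k => i.1.2.1 < k).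
  by exists i.1.2.1.+1.
have [i il|K3 K3P] := eventually_all _ l
    (fun i k => forall j, j \in l -> key i k = key j k -> i = j).
  apply: eventually_all => j jl; exact: key_eventually_inj.
(* Beyond [K1] the column leaves the small sets, beyond [K2] it leaves the base points, beyond [K3]
   keys are distinct; the last bound gives [z' <> z]. Listing the keys of the sets that contain [z]
   gives [z'] the same memberships. *)
pose k := maxn (maxn K1 K2) (maxn K3 z.2.1.+1).
have K1k : K1 <= k by rewrite /k !leq_max leqnn.
have K2k : K2 <= k by rewrite /k !leq_max leqnn orbT.
have K3k : K3 <= k by rewrite /k !leq_max leqnn !orbT.
have zk : z.2.1 < k by rewrite /k !leq_max leqnn !orbT.
pose z' : pt := (n, (k, [seq key i k | i <- [seq i <- l | `[< nbh i z >]]])).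
exists z'; split=> //; last by move=> e; rewrite -e /= ltnn in zk.
apply: lP bz => i il; split=> [nz|].
  right; split; first exact: K1P.
  by apply: map_f; rewrite mem_filter il andbT; apply/asboolP.
case=> [e|[_ /mapP[j]]].
  by have := K2P _ K2k _ il; rewrite -e /= ltnn.
rewrite mem_filter => /andP[/asboolP nj jl] e.
by rewrite (K3P _ K3k _ il _ jl e).
Qed.

(** * Maximal spaces and D-separability *)

Section Crowded.
Context {X : topologicalType}.
Implicit Types (S U V : set X).

Lemma crowdedP : crowded X <->
  forall U x, open U -> U x -> exists2 y, U y & y <> x.
Proof.
split=> [cr U x oU Ux|h].
  apply: contrapT => ny; have : isolated [set: X] x.
    split; first by rewrite inE.
    exists U; first exact: open_nbhs_nbhs.
    rewrite setIT; apply/seteqP; split=> y => [Uy|->//].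
    by apply: contrapT => yx; apply: ny; exists y.
  by rewrite cr.
apply/seteqP; split=> // x [_ [V]].
rewrite setIT nbhsE => -[U [oU Ux] UV] Vx.
have [y /UV Vy yx] := h _ _ oU Ux.
by apply: yx; rewrite Vx in Vy.
Qed.

(** A set open in a finer crowded topology has no isolated point in [X], since the singleton of such
    a point would be open in the finer topology. *)
Lemma maximal_spaceI : crowded X ->
  (forall U, isolated U = set0 -> open U) -> maximal_space X.
Proof.
move=> crX h; split=> // c Y [XY nYX] crY; apply: nYX => U oU; apply: h.
apply/seteqP; split=> // x [/set_mem Ux [V]].
rewrite nbhsE => -[V' [oV' V'x] V'V] VU.
have : @isolated Y setT x.
  split; first by rewrite inE.
  exists (V' `&` U).
    apply: (@open_nbhs_nbhs Y); split=> //.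
    by apply: openI => //; exact: XY.
  rewrite setIT; apply/seteqP; split=> y => [[/V'V Vy Uy]|->//].
  by rewrite -VU.
by rewrite crY.
Qed.

Hypotheses (T1X : accessible_space X) (crX : crowded X).
Hypothesis openX : forall U, isolated U = set0 -> open U.

(** If [S] had an isolated point, deleting it from a neighbourhood would, by T1 and crowdedness,
    leave room for a nonempty open set missing [S]. *)
Lemma dense_open S : dense S -> open S.
Proof.
move=> dS; apply: openX; apply/seteqP; split=> // x [_ [V]].
rewrite nbhsE => -[U [oU Ux] UV] VS.
have /crowdedP/(_ _ _ oU Ux)[y Uy yx] := crX.
have [|A [oA /set_mem Ay /set_mem nAx]] := @T1X y x; first exact/eqP.
have [|z [[Uz Az] Sz]] := dS (U `&` A) _ (openI oU oA); first by exists y.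
have : [set x] z by rewrite -VS; split=> //; exact: UV.
by move=> /= zx; rewrite zx in Az.
Qed.

(** Adding any [U] to the complement of [S] gives a dense, hence open, set with the same trace on
    [S] as [U]. *)
Lemma codense_discrete S : dense (~` S) -> discrete_subset S.
Proof.
move=> dS U; apply/open_subspaceP; exists (~` S `|` U).
  apply: dense_open => O O0 oO; have [x [Ox nSx]] := dS _ O0 oO.
  by exists x; split=> //; left.
by apply/seteqP; split=> x [] => [[//|Ux Sx]|Ux Sx]; split=> //; right.
Qed.

Lemma countable_D_separable : countable [set: X] -> D_separable X.
Proof.
move=> /countable_injP[f finj] D dD.
pose E n := [set x | forall i, i <= n -> D i x].
have dE n : dense (E n).
  elim: n => [|n IH].
    rewrite (_ : E 0 = D 0) //; apply/seteqP; split=> x; first exact.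
    by move=> D0x i; rewrite leqn0 => /eqP ->.
  rewrite (_ : E n.+1 = E n `&` D n.+1).
    exact: denseI (dense_open _ IH) IH (dD _).
  apply/seteqP; split=> x => [Ex|[Ex Dx] i].
    by split; [move=> i ilen; apply: Ex; exact: leqW|exact: Ex].
  by rewrite leq_eqVlt => /predU1P[->|]; [|exact: Ex].
pose F n := (E n `\` E n.+1) `|` [set x | (forall i, E i x) /\ f x = n].
exists F; split=> [n|].
  split; last by move=> x [[Ex _]|[Ex _]]; [exact: Ex|exact: (Ex n)].
  apply: codense_discrete.
  (* The complement of [F n] contains [E n.+1] minus the at most one point with code [n]. *)
  have dn : dense [set x | f x <> n].
    move=> O [x Ox] oO; have [fx|fx] := pselect (f x = n); last by exists x.
    have /crowdedP/(_ _ _ oO Ox)[y Oy yx] := crX.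
    exists y; split=> //= fy; apply: yx; apply: finj; rewrite ?inE //.
    by rewrite fx.
  have := denseI (dense_open _ (dE n.+1)) (dE n.+1) dn.
  move=> d O O0 oO; have [x [Ox [Ex fx]]] := d _ O0 oO.
  by exists x; split=> // -[[_]|[_]].
move=> O O0 oO; have [x [Ox E0x]] := dE 0 _ O0 oO.
exists x; split=> //.
have [Ex|/existsNP nE] := pselect (forall i, E i x).
  by exists (f x) => //; right.
have nEx : exists n, ~~ `[< E n x >] by case: nE => n nEn; exists n; exact/asboolPn.
case: (ex_minnP nEx) => -[|n] /asboolPn nEn nmin //.
exists n => //; left; split=> //; apply: contrapT => /asboolPn /nmin.
by rewrite ltnn.
Qed.

End Crowded.

(* [algB] is a phantom argument on which the topology instance depends. *)
Definition trace_space (X : choiceType) (B : set (set X)) (Y : set X)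
  (algB : set_algebra B) : Type := {x : X | `[< Y x >]}.

(** * The topology that an algebra induces on a subset *)

Section TraceSpace.
Context (X : countType) (B : set (set X)) (Y : set X) (algB : set_algebra B).
Local Notation T := (trace_space X B Y algB).

HB.instance Definition _ := Countable.copy T {x : X | `[< Y x >]}.

Definition trace_open (U : set T) :=
  forall x, U x -> exists b, [/\ B b, b (val x) & forall y : T, b (val y) -> U y].

Fact trace_openT : trace_open setT.
Proof. by have [BT _ _] := algB; move=> x _; exists setT. Qed.

Fact trace_openI : setI_closed trace_open.
Proof.
have [_ _ BI] := algB.
move=> U V oU oV x [/oU[b [Bb bx bU]] /oV[c [Bc cx cV]]].
exists (b `&` c); split=> [||y [by' cy]] //; first exact: BI.
by split; [exact: bU|exact: cV].
Qed.

Fact trace_open_bigU (I : Type) (f : I -> set T) :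
  (forall i, trace_open (f i)) -> trace_open (\bigcup_i f i).
Proof.
move=> of_ x [i _ /of_[b [Bb bx bU]]]; exists b; split=> // y /bU fy.
by exists i.
Qed.

HB.instance Definition _ :=
  isOpenTopological.Build T trace_openT trace_openI trace_open_bigU.

Lemma trace_space_openE (U : set T) : open U = trace_open U.
Proof. by []. Qed.

Lemma trace_spaceP (x : T) : Y (val x).
Proof. by case: x => x /= /asboolP. Qed.

Lemma trace_space_ex x : Y x -> exists y : T, val y = x.
Proof. by move=> /asboolP Yx; exists (exist _ x Yx). Qed.

Lemma open_trace b : B b -> open [set x : T | b (val x)].
Proof. by rewrite trace_space_openE => Bb x bx; exists b. Qed.

Lemma nbhs_trace (x : T) (A : set T) : nbhs x A ->
  exists b, [/\ B b, b (val x) & forall y : T, b (val y) -> A y].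
Proof.
rewrite nbhsE => -[U [oU Ux] UA]; have [b [Bb bx bU]] := oU _ Ux.
by exists b; split=> // y /bU/UA.
Qed.

Lemma trace_countable : countable [set: T].
Proof. exact: countableP. Qed.

Hypothesis T1B : forall x y : X, x <> y -> exists b, [/\ B b, b x & ~ b y].

Lemma trace_regular_T1 : regular_T1 T.
Proof.
have [_ BC _] := algB.
split=> [x y /eqP xy|x A Ax].
  have [|b [Bb bx nby]] := T1B (val x) (val y); first by move/val_inj.
  by exists [set x : T | b (val x)]; split; rewrite ?inE //; exact: open_trace.
have [b [Bb bx bA]] := nbhs_trace _ _ Ax.
exists [set x : T | b (val x)].
  by apply: open_nbhs_nbhs; split=> //; exact: open_trace.
move=> y cly; apply: bA; apply: contrapT => nby.
have [|z []] := cly [set x : T | (~` b) (val x)]; last by [].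
by apply: open_nbhs_nbhs; split=> //; apply: open_trace; exact: BC.
Qed.

Hypothesis diiY : dense_in_itself B Y.

Lemma trace_crowded : crowded T.
Proof.
apply/crowdedP => U x oU Ux; have [b [Bb bx bU]] := oU _ Ux.
have [y [Yy by' yx]] := diiY _ _ (trace_spaceP x) Bb bx.
have [z zy] := trace_space_ex _ Yy.
exists z; first by apply: bU; rewrite zy.
by move=> zx; apply: yx; rewrite -zy zx.
Qed.

Hypothesis openB : forall C, C `<=` Y -> dense_in_itself B C ->
  forall x, C x -> exists b, [/\ B b, b x & Y `&` b `<=` C].

(** Seen in [X], a set without isolated points is dense in itself, so [openB] supplies its basic
    neighbourhoods. *)
Lemma trace_open_of_isolated (U : set T) : isolated U = set0 -> open U.
Proof.
rewrite trace_space_openE => U0 x Ux; have [||| b [Bb bx bU]] := openB (val @` U) _ _ (val x).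
- by move=> _ [y _ <-]; exact: trace_spaceP.
- move=> _ b [y Uy <-] Bb by'; apply: contrapT => nz.
  have : isolated U y; last by rewrite U0.
  split; first by rewrite inE.
  exists [set x : T | b (val x)].
    by apply: open_nbhs_nbhs; split=> //; exact: open_trace.
  apply/seteqP; split=> z => [[bz Uz]|->//].
  apply: contrapT => zy; apply: nz; exists (val z); split=> // /val_inj.
  exact: zy.
- by exists x.
exists b; split=> // y by'.
have [|z Uz /val_inj <-//] := bU (val y).
by split=> //; exact: trace_spaceP.
Qed.

End TraceSpace.

(** * Failure of selective separability *)

Lemma finite_bounded (A : Type) (S : set A) (g : A -> nat) : finite_set S ->
  exists M, forall x, S x -> g x < M.
Proof.
move=> fS; have := finite_image g fS => /finite_seqP[s sE].
exists (\max_(i <- s) i).+1 => x Sx; rewrite ltnS.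
have : [set` s] (g x) by rewrite -sE; exists x.
by move=> /= xs; apply: (@leq_bigmax_seq _ s xpredT id).
Qed.

Lemma trace_not_selectively_separable (B : set (set pt)) Y
    (algB : set_algebra B) : dense_in_itself B Y ->
  (forall x y : pt, x <> y -> exists b, [/\ B b, b x & ~ b y]) ->
  (forall J x, small J -> exists b, [/\ B b, b x & forall y, b y -> J y -> y = x]) ->
  Y !=set0 -> ~ selectively_separable (trace_space pt B Y algB).
Proof.
move=> diiY T1B smB [x0 Yx0]; have [_ _ BI] := algB.
set T := trace_space _ _ _ _.
have dJ J : small J -> dense [set x : T | ~ J (val x)].
  move=> smJ O [x Ox] oO; have [b [Bb bx bO]] := oO _ Ox.
  have [c [Bc cx cJ]] := smB _ (val x) smJ.
  have [y [Yy [by' cy] yx]] := diiY _ _ (trace_spaceP _ _ _ _ x) (BI _ _ Bb Bc) (conj bx cx).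
  have [z zy] := trace_space_ex _ B _ algB _ Yy.
  by exists z; split=> /=; rewrite ?zy //; [apply: bO; rewrite zy|move=> /(cJ _ cy)].
pose D n := [set x : T | ~ (val x).1 < n].
have dD n : dense (D n).
  apply: (dJ [set x : pt | x.1 < n]); exists n => m nm; exists 0 => k h /=.
  by rewrite ltnNge nm.
move=> /(_ D dD)[F [Ffin Fdense]].
pose J : set pt := [set x | exists n y, F n y /\ val y = x].
have smJ : small J.
  (* [F i] avoids the columns before [i], so only the finite sets [F 0] to [F n] can meet column
     [n]. *)
  exists 0 => n _.
  have [i _|M MP] := eventually_all _ (iota 0 n.+1)
      (fun i M => forall y, F i y -> (val y).2.1 < M).
    have [finFi _] := Ffin i.
    have [M MP] := finite_bounded _ _ (fun y => (val y).2.1) finFi.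
    by exists M => k Mk y /MP /leq_trans; apply.
  exists M => k h [i [y [Fy yE]]].
  have [_ FD] := Ffin i; have /negP : ~ (val y).1 < i := FD _ Fy.
  rewrite yE -leqNgt => /= ni.
  have := MP _ (leqnn M) i; rewrite mem_iota add0n ltnS ni => /(_ isT _ Fy).
  by rewrite yE.
have [y0 _] := trace_space_ex _ B _ algB _ Yx0.
(* [c] meets the union of the [F n] at most in [y0]; cutting [y0] off leaves a nonempty open set
   that misses the union. *)
have [c [Bc cx cJ]] := smB _ (val y0) smJ.
have crT : crowded T by exact: trace_crowded.
have [|z cz zy0] := (crowdedP.1 crT) _ y0 (open_trace _ _ _ algB _ Bc); first by [].
have [|a [Ba az nay]] := T1B (val z) (val y0); first by move/val_inj.
have [||w [[cw aw] [i _ Fw]]] := Fdense [set x : T | (c `&` a) (val x)].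
- by exists z.
- by apply: open_trace; exact: BI.
have e : val w = val y0 by apply: cJ => //; exists i, w.
by rewrite e in aw.
Qed.

Theorem corollary74 :
  exists X : topologicalType,
    [/\ countable [set: X],
        regular_T1 X,
        maximal_space X,
        D_separable X
      & ~ selectively_separable X].
Proof.
have [B Bmax B0B] := maximal_algebra_exists _ start_algebraP start_algebra_dense.
have smB J x : small J -> exists b, [/\ B b, b x & forall y, b y -> J y -> y = x].
  by move=> /(start_algebra_small _ x)[b [/B0B ? ? ?]]; exists b.
have T1B (x y : pt) : x <> y -> exists b, [/\ B b, b x & ~ b y].
  move=> xy; have [b [Bb bx bP]] := smB _ x (small1 y).
  by exists b; split=> // by'; apply: xy; rewrite (bP _ by').
have pt0 : [set: pt] !=set0 by exists (0, (0, [::])).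
have [Y [Yn0 diiY openY]] := maximal_subset_exists _ _ Bmax T1B pt0.
have [algB _ _] := Bmax.
have regT := trace_regular_T1 _ _ Y algB T1B.
have crT := trace_crowded _ _ _ algB diiY.
have opT := trace_open_of_isolated _ _ _ algB openY.
exists (trace_space pt B Y algB); split=> //.
- exact: trace_countable.
- exact: maximal_spaceI.
- by apply: countable_D_separable => //; [case: regT|exact: trace_countable].
- exact: trace_not_selectively_separable.
Qed.
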